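(* Let $S_0,S_1,S_2$ be positive integers with $\gcd(S_0,S_1,S_2)=1$, let $S:\{0,1,2\}^*\to\mathbb{N}$ be the semigroup homomorphism with $S(i)=S_i$, and let $\mathbf t=T(\mathbf f)$. Define $k_1=o_1=\tfrac12S_0-S_1+\tfrac12S_2$, $k_2=o_2=\tfrac12S_0-\tfrac12S_2$, $k_3=o_3=-\tfrac12S_0+\tfrac12S_2$, $k_4=e_1=S_0-S_1$, $k_5=e_2=-S_1+S_2$, $k_6=e_3=0$, $k=\max\{|k_i|:1\le i\le6\}$, and $l=\left\lceil \frac{2(k+1)}{\min\{S_1,\,k_1+S_1\}}\right\rceil$. Let $F=(F[n])_{n\ge1}$ with $F[n]=k_1+S_1$ if $\mathbf f[n]=0$ and $F[n]=S_1$ if $\mathbf f[n]=1$. For $1\le i\le j$ let $I(F[i,j])$ be the real interval $\left[k+1,\ \sum_{q=i}^{j+1}F[q]-(k+1)\right]$, \[\mathbb S^0(F[i,j])=\Big\{\textstyle\sum_{q=i}^sF[q]+e_r+(o_r-e_r)\big(|\mathbf f[i,s]|_0\bmod 2\big): r\in\{1,2,3\},\ i\le s\le j\Big\},\] \[\mathbb S^1(F[i,j])=\Big\{\textstyle\sum_{q=i}^sF[q]+e_r+(o_r-e_r)\big(1-(|\mathbf f[i,s]|_0\bmod 2)\big): r\in\{1,2,3\},\ i\le s\le j\Big\},\] $\mathbb K^0(F[i,j])=\big(I(F[i,j])\setminus\mathbb S^0(F[i,j])\big)\cap\mathbb N$ and $\mathbb K^1(F[i,j])=\big(((k_1+S_1)+I(F[i,j]))\setminus((k_1+S_1)+\mathbb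 S^1(F[i,j]))\big)\cap\mathbb N$. Then $\mathbb N\setminus S(\mathcal L_{\mathbf t})$ is finite if and only if $\mathbb K^0(F[i,i+l-1])=\mathbb K^1(F[i,i+l-1])=\emptyset$ for all $i\ge1$.
   Context: $\varphi=(1+\sqrt5)/2$, $\alpha=2-\varphi$, $\mathbf{f}=(\lfloor (n+1)\alpha\rfloor-\lfloor n\alpha\rfloor)_{n\ge1}$ is the Fibonacci word, $\mathbf f[n]$ its $n$-th letter and $\mathbf f[i,s]=\mathbf f[i]\cdots\mathbf f[s]$; $|w|_0$ is the number of $0$'s in $w$. $T$ keeps each $1$ and, among the occurrences of $0$ in order, replaces the 2nd, 4th, 6th, $\dots$ by $2$. For $c\in\mathbb R$ and $A\subseteq\mathbb R$, $c+A=\{c+a:a\in A\}$. $\mathcal L_{\mathbf t}$ is the set of factors of $\mathbf t$ and $S(\mathcal L_{\mathbf t})=\{S(u):u\in\mathcal L_{\mathbf t}\}$, where $S(uv)=S(u)+S(v)$. *)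

(* Defs.v *)
From mathcomp Require Import all_boot all_order all_algebra.
From mathcomp Require Import all_classical all_reals.

Import Order.TTheory GRing.Theory Num.Theory.

Local Open Scope classical_set_scope.
Local Open Scope ring_scope.

(* An infinite word over T is a map [nat -> T] read at the indices n >= 1; its
   value at 0 is irrelevant.  The alphabet {0, 1, 2} is ['I_3]; the binary word
   f keeps its letters in [int], as produced by the floors defining it. *)

Definition golden (R : realType) : R := (1 + Num.sqrt 5) / 2.

Definition alpha (R : realType) : R := 2 - golden R.

Definition fibword (R : realType) (n : nat) : int :=
  Num.floor (n.+1%:R * alpha R) - Num.floor (n%:R * alpha R).

(* w[i,s] = w[i] ... w[s]; this is the empty word when s < i *)
Definition wfactor {T : Type} (w : nat -> T) (i s : nat) : seq T :=
  [seq w q | q <- index_iota i s.+1].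

Definition language {T : Type} (w : nat -> T) : set (seq T) :=
  [set u | exists i s : nat, (1 <= i)%N /\ u = wfactor w i s].

Definition zeros (u : seq int) : nat := count_mem 0 u.

(* The operator T on words over {0, 1}: an occurrence of 0 at position n is the
   [zeros (wfactor w 1 n)]-th one, and is replaced by 2 when that rank is even. *)
Definition Tword (w : nat -> int) (n : nat) : 'I_3 :=
  if w n == 0 then (if odd (zeros (wfactor w 1 n)) then 0 else 2) else 1.

Definition translate {R : realType} (c : R) (A : set R) : set R :=
  [set c + a | a in A].

Definition naturals (R : realType) : set R := [set n%:R | n in [set: nat]].

(* Only the indices 1, ..., 6 are meaningful. *)
Definition kc (R : realType) (S0 S1 S2 i : nat) : R :=
  match i with
  | 1%N => S0%:R / 2 - S1%:R + S2%:R / 2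
  | 2%N => S0%:R / 2 - S2%:R / 2
  | 3%N => - (S0%:R / 2) + S2%:R / 2
  | 4%N => S0%:R - S1%:R
  | 5%N => - S1%:R + S2%:R
  | _ => 0
  end.

(* o_r and e_r, for r in {1, 2, 3} *)
Definition oc (R : realType) (S0 S1 S2 r : nat) : R := kc R S0 S1 S2 r.
Definition ec (R : realType) (S0 S1 S2 r : nat) : R := kc R S0 S1 S2 (r + 3).

Definition kmax (R : realType) (S0 S1 S2 : nat) : R :=
  \big[Num.max/0]_(1 <= i < 7) `|kc R S0 S1 S2 i|.

(* The ceiling is positive when S0, S1, S2 are, so the absolute value only
   casts it to nat. *)
Definition lwin (R : realType) (S0 S1 S2 : nat) : nat :=
  absz (Num.ceil (2 * (kmax R S0 S1 S2 + 1) /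
                  Num.min S1%:R (kc R S0 S1 S2 1 + S1%:R))).

Definition Fword (R : realType) (S0 S1 S2 n : nat) : R :=
  if fibword R n == 0 then kc R S0 S1 S2 1 + S1%:R else S1%:R.

(* The sets I(F[i,j]), S^0(F[i,j]), S^1(F[i,j]), K^0(F[i,j]), K^1(F[i,j]) depend
   on the position (i, j) and not only on the word F[i,j]: the first involves
   F[j+1], the others the letters of f. *)

Definition Iset (R : realType) (S0 S1 S2 i j : nat) : set R :=
  `[kmax R S0 S1 S2 + 1,
    \sum_(i <= q < j.+2) Fword R S0 S1 S2 q - (kmax R S0 S1 S2 + 1)]%classic.

Definition Sset0 (R : realType) (S0 S1 S2 i j : nat) : set R :=
  [set x | exists r s : nat, [/\ (1 <= r <= 3)%N, (i <= s <= j)%N &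
     x = \sum_(i <= q < s.+1) Fword R S0 S1 S2 q + ec R S0 S1 S2 r
         + (oc R S0 S1 S2 r - ec R S0 S1 S2 r)
           * (zeros (wfactor (fibword R) i s) %% 2)%:R]].

Definition Sset1 (R : realType) (S0 S1 S2 i j : nat) : set R :=
  [set x | exists r s : nat, [/\ (1 <= r <= 3)%N, (i <= s <= j)%N &
     x = \sum_(i <= q < s.+1) Fword R S0 S1 S2 q + ec R S0 S1 S2 r
         + (oc R S0 S1 S2 r - ec R S0 S1 S2 r)
           * (1 - (zeros (wfactor (fibword R) i s) %% 2)%:R)]].

Definition Kset0 (R : realType) (S0 S1 S2 i j : nat) : set R :=
  (Iset R S0 S1 S2 i j `\` Sset0 R S0 S1 S2 i j) `&` naturals R.

Definition Kset1 (R : realType) (S0 S1 S2 i j : nat) : set R :=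
  let c := kc R S0 S1 S2 1 + S1%:R in
  (translate c (Iset R S0 S1 S2 i j) `\` translate c (Sset1 R S0 S1 S2 i j))
    `&` naturals R.

(* Main.v *)
(* Over the factors of T(f) of length n, the sum S takes the values
   [base n + o_r] (r = 1, 2, 3) if f[1, n-1] has an odd number of zeros and
   [base n + e_r] otherwise, where [base n] is the sum of the real weights F
   over 1f[1, n-1].  As all these shifts are at most k in absolute value, the
   values of S in [base i + I(F[i, i+l-1])] come from the prefixes of 1f that
   end inside the window, so the sets K^0 and K^1 list the integers missed
   there, according to the parity of the number of zeros in f[1, i-1].
   Consecutive windows overlap, and each window recurs infinitely often with
   either parity; the latter, as well as the occurrence of all the values above,
   follows from the density of the fractional parts of n * alpha. *)

Require Import Defs.
From mathcomp Require Import all_boot all_order all_algebra.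
From mathcomp Require Import all_classical all_reals.
From mathcomp Require Import zify ring lra.

Import Order.TTheory GRing.Theory Num.Theory.

Local Open Scope classical_set_scope.
Local Open Scope ring_scope.

(** * Small multiples of [alpha] modulo 1 *)

Lemma alpha_gt0 (R : realType) : 0 < alpha R.
Proof.
rewrite /alpha /golden; have := sqr_sqrtr (ler0n R 5); have := sqrtr_ge0 (5 : R).
move: (Num.sqrt 5) => s s0 s5; rewrite expr2 in s5; nra.
Qed.

Lemma alpha_lt_half (R : realType) : alpha R < 1 / 2.
Proof.
rewrite /alpha /golden; have := sqr_sqrtr (ler0n R 5); have := sqrtr_ge0 (5 : R).
move: (Num.sqrt 5) => s s0 s5; rewrite expr2 in s5; nra.
Qed.

Lemma alpha_sqr (R : realType) : alpha R * alpha R = 3 * alpha R - 1.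
Proof.
rewrite /alpha /golden; have := sqr_sqrtr (ler0n R 5).
move: (Num.sqrt 5) => s s5; rewrite expr2 in s5; nra.
Qed.

(** By [alpha_sqr], multiplication by [alpha] sends the pair (a, b) to (3a - b, a); the bound
    [b <= a] keeps the subtraction in [nat] exact. *)
Lemma alpha_exp (R : realType) (k : nat) :
  exists a b : nat, (b <= a)%N /\ a%:R * alpha R - b%:R = alpha R ^+ k.+1.
Proof.
elim: k => [|k [a [b [leba abE]]]].
  by exists 1%N, 0%N; split => //; rewrite expr1; ring.
exists (3 * a - b)%N, a; split; first lia.
rewrite exprSr -abE natrB; last lia.
have -> : (a%:R * alpha R - b%:R) * alpha R =
    a%:R * (alpha R * alpha R) - b%:R * alpha R.
  by ring.
by rewrite alpha_sqr; ring.
Qed.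

Lemma small_multiple (R : realType) (e : R) : 0 < e ->
  exists a b : nat, 0 < a%:R * alpha R - b%:R < e.
Proof.
move=> e0; have [a [b [_ abE]]] := alpha_exp R (Num.bound e^-1).
exists a, b; rewrite abE exprn_gt0 ?alpha_gt0 //=.
(* As [alpha < 1/2], this power of [alpha] is at most the inverse of the same power of 2, which
   exceeds [e^-1]. *)
have hp : 2 ^+ (Num.bound e^-1).+1 * alpha R ^+ (Num.bound e^-1).+1 <= 1.
  rewrite -exprMn; apply: exprn_ile1; first by rewrite mulr_ge0 ?ltW ?alpha_gt0.
  by have h := alpha_lt_half R; lra.
have hb : e^-1 < 2 ^+ (Num.bound e^-1).+1 :> R by apply: upper_nthrootP.
have h2 : 0 < 2 ^+ (Num.bound e^-1).+1 :> R by rewrite exprn_gt0.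
rewrite -(ltr_pM2l h2) (le_lt_trans hp) //.
by rewrite -(@ltr_pM2r _ e) // mulVf ?gt_eqF in hb.
Qed.

(** * Floors and fractional parts of the multiples of [alpha] *)

Definition beatty (R : realType) (n : nat) : int := Num.floor (n%:R * alpha R).

Definition fracpart (R : realType) (n : nat) : R :=
  n%:R * alpha R - (beatty R n)%:~R.

Lemma fracpart_itv (R : realType) (n : nat) : 0 <= fracpart R n < 1.
Proof.
rewrite /fracpart /beatty; have := floor_itv (n%:R * alpha R).
rewrite intrD; lra.
Qed.

Lemma beatty_eq {R : realType} {n : nat} {m : int} {x : R} :
  n%:R * alpha R = m%:~R + x -> 0 <= x < 1 -> beatty R n = m.
Proof. by move=> nE x01; apply: floor_def; rewrite nE intrD; lra. Qed.

Lemma beattyD (R : realType) (i n : nat) (c : int) :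
  0 <= fracpart R i + fracpart R n - c%:~R < 1 ->
  beatty R (i + n) = beatty R i + beatty R n + c.
Proof.
apply: beatty_eq; rewrite /fracpart natrD !intrD; ring.
Qed.

(* If a * alpha exceeds an integer by less than v - u, then steps of length a
   cannot jump over the interval ]u, v[ modulo 1. *)
Lemma fracpart_dense (R : realType) (N : nat) (u v : R) :
  0 <= u -> u < v -> v <= 1 ->
  exists n : nat, (N <= n)%N /\ u < fracpart R n < v.
Proof.
move=> u0 uv v1; have [|a [b /andP[d0 dlt]]] := small_multiple R (v - u); first lra.
set d := a%:R * _ - _ in d0 dlt.
have /andP[x0 x1] := fracpart_itv R N; set x := fracpart R N in x0 x1.
(* A real number [y] of steps of length [d] leads from [x] to 1 + u, so floor y + 1 steps end in ]1
   + u, 1 + u + d], before 1 + v. The target 1 + u exceeds [x], whence [0 <= y]. *)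
pose y := (1 + u - x) / d.
have y0 : 0 <= y by rewrite /y divr_ge0; lra.
have yd : y * d = 1 + u - x by rewrite /y divfK ?gt_eqF.
pose t := `|Num.floor y|.+1%N.
have tE : (t%:R : R) = (Num.floor y)%:~R + 1.
  by rewrite -natr1 natr_absz ger0_norm // floor_ge0.
have /andP[f1 f2] := floor_itv y; rewrite intrD in f2.
have td : 1 + u < x + t%:R * d < 1 + v by rewrite tE; nra.
have nE : (N + a * t)%:R * alpha R =
    (beatty R N + (b * t)%:Z + 1)%:~R + (x + t%:R * d - 1).
  by rewrite /x /d /fracpart !intrD natrD natrM -pmulrn natrM; ring.
exists (N + a * t)%N; split; first by rewrite leq_addr.
rewrite /fracpart (beatty_eq nE); last lra.
by rewrite nE; lra.
Qed.

(** Irrationality of [alpha]: if n * alpha were an integer, n * (a * alpha - b) would be an integer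
    in ]0, 1[ for suitable a, b. *)
Lemma fracpart_gt0 (R : realType) (n : nat) : (0 < n)%N -> 0 < fracpart R n.
Proof.
move=> n0; rewrite lt_neqAle; have /andP[-> _] := fracpart_itv R n; rewrite andbT.
apply/negP => /eqP f0; have n0R : 0 < (n%:R : R) by rewrite ltr0n.
have [|a [b /andP[d0 dlt]]] := small_multiple R n%:R^-1; first by rewrite invr_gt0.
have nn : n%:R * n%:R^-1 = 1 :> R by rewrite divff ?gt_eqF.
rewrite -(ltr_pM2l n0R) nn in dlt; move: dlt.
have dE : n%:R * (a%:R * alpha R - b%:R) = (a%:Z * beatty R n - (n * b)%:Z)%:~R :> R.
  have -> : a%:Z * beatty R n - (n * b)%:Z = a%:Z * beatty R n - n%:Z * b%:Z by lia.
  rewrite intrD intrM intrN intrM -!pmulrn.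
  by move: f0; rewrite /fracpart => f0; nra.
have : 0 < n%:R * (a%:R * alpha R - b%:R) by exact: mulr_gt0.
rewrite dE ltr0z ltrz1; lia.
Qed.

(** * Zero counts and recurrence in the Fibonacci word *)

Lemma fibwordE (R : realType) (n : nat) :
  fibword R n = beatty R n.+1 - beatty R n.
Proof. by []. Qed.

Lemma fibword_itv (R : realType) (n : nat) : (0 <= fibword R n <= 1)%R.
Proof.
rewrite fibwordE.
have nE : n.+1%:R * alpha R = (beatty R n)%:~R + (fracpart R n + alpha R).
  by rewrite /fracpart -natr1; ring.
have := fracpart_itv R n; have := alpha_gt0 R; have := alpha_lt_half R => a1 a0 f01.
have [lt1|ge1] := ltP (fracpart R n + alpha R) 1.
  by rewrite (beatty_eq nE); [lia|lra].
have nE' : n.+1%:R * alpha R = (beatty R n + 1)%:~R + (fracpart R n + alpha R - 1).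
  by rewrite nE intrD; ring.
by rewrite (beatty_eq nE'); [lia|lra].
Qed.

Definition zcount (R : realType) (i n : nat) : nat :=
  zeros [seq fibword R q | q <- iota i n].

Lemma zcount_cat (R : realType) (i m n : nat) :
  zcount R i (m + n) = (zcount R i m + zcount R (i + m) n)%N.
Proof. by rewrite /zcount /zeros iotaD map_cat count_cat. Qed.

Lemma zcountS (R : realType) (i n : nat) :
  zcount R i n.+1 = (zcount R i n + (fibword R (i + n) == 0))%N.
Proof. by rewrite -addn1 zcount_cat /zcount /zeros /= addn0. Qed.

(** The letters are 0 or 1 and their sum telescopes to a difference of floors; the remaining letters
    are the zeros. *)
Lemma zcountE (R : realType) (i n : nat) :
  (zcount R i n)%:Z = n%:Z - (beatty R (i + n) - beatty R i).
Proof.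
elim: n => [|n IHn]; first by rewrite addn0 subrr.
rewrite zcountS PoszD IHn addnS.
have := fibword_itv R (i + n); rewrite fibwordE.
case: eqP; lia.
Qed.

Lemma zcount_le (R : realType) (i n : nat) : (zcount R i n <= n)%N.
Proof.
by rewrite /zcount /zeros (leq_trans (count_size _ _)) // size_map size_iota.
Qed.

Lemma beatty1 (R : realType) : beatty R 1 = 0.
Proof.
apply: (@beatty_eq R _ _ (alpha R)); first by rewrite add0r mul1r.
have := alpha_gt0 R; have := alpha_lt_half R; lra.
Qed.

Lemma zcount_prefix (R : realType) (n : nat) : (0 < n)%N ->
  (zcount R 1 n.-1)%:Z = n%:Z - 1 - beatty R n.
Proof. by move=> n0; rewrite zcountE beatty1 add1n prednK //; lia. Qed.

(* For n = 2m, if m * alpha lies modulo 1 in ]u/2, v/2[ or ](1+u)/2, (1+v)/2[,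
   then n * alpha lies in ]u, v[ and has an even, respectively odd, integer
   part. *)
Lemma fracpart_dense_parity (R : realType) (N : nat) (u v : R) (p : bool) :
  0 <= u -> u < v -> v <= 1 ->
  exists n : nat, [/\ (N < n)%N, u < fracpart R n < v & odd (zcount R 1 n.-1) = p].
Proof.
move=> u0 uv v1; pose c := (~~ p)%:Z.
have c01 : 0 <= (c%:~R : R) <= 1 by rewrite /c; case: (p) => /=; lra.
have [||| m [leNm /andP[xu xv]]] :=
  fracpart_dense R N.+1 ((c%:~R + u) / 2) ((c%:~R + v) / 2); [lra..|].
have m0 : (0 < m)%N by lia.
have nE : (2 * m)%:R * alpha R =
    (2 * beatty R m + c)%:~R + (2 * fracpart R m - c%:~R).
  by rewrite /fracpart natrM intrD intrM; ring.
have bE : beatty R (2 * m) = 2 * beatty R m + c.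
  by apply: beatty_eq nE _; have := fracpart_itv R m; lra.
exists (2 * m)%N; split; first lia.
  by rewrite /fracpart bE nE; lra.
have := zcount_prefix R (2 * m); rewrite bE /c => /(_ ltac:(lia)).
by clear; case: p => /=; lia.
Qed.

(** Floors add up to a carry of 0 or 1 ([beattyD]); the extra zero is there exactly when nothing is
    carried. *)
Lemma zcount_range (R : realType) (i n : nat) : (0 < n)%N ->
  exists b : bool, zcount R i n = (zcount R 1 n.-1 + b)%N.
Proof.
move=> n0; have := zcount_prefix R n n0; have := zcountE R i n.
have := fracpart_itv R i; have := fracpart_itv R n => fn fi.
have [lt1|ge1] := ltP (fracpart R i + fracpart R n) 1.
  rewrite (@beattyD R i n 0); last lra.
  by move=> zi z1; exists true; lia.
rewrite (@beattyD R i n 1); last by rewrite mulr1z; lra.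
by move=> zi z1; exists false; lia.
Qed.

Lemma zcount_realize (R : realType) (n : nat) (b p : bool) : (0 < n)%N ->
  exists i : nat, [/\ (0 < i)%N, zcount R i n = (zcount R 1 n.-1 + b)%N
    & odd (zcount R 1 i.-1) = p].
Proof.
move=> n0; have := zcount_prefix R n n0.
have := fracpart_gt0 R n n0; have := fracpart_itv R n => fn fn0 z1.
(* On ]u, v[ the fractional part of [i] produces no carry if [b], and a carry otherwise. Both
   intervals are nonempty as 0 < fracpart n < 1. *)
pose u := if b then 0 else 1 - fracpart R n.
pose v := if b then 1 - fracpart R n else 1.
have [||| i [i0 fi podd]] := fracpart_dense_parity R 0 u v p;
  [rewrite /u /v; case: (b); lra..|].
exists i; split => //; have := zcountE R i n.
rewrite (@beattyD R i n (~~ b)%:Z); first by case: (b); lia.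
by move: fi; rewrite /u /v; case: (b) => /=; lra.
Qed.

(** The finitely many fractional parts at i + q are below 1, so a small shift to the right pushes
    none of them past 1. *)
Lemma beatty_right_stable (R : realType) (i L : nat) :
  exists2 e : R, 0 < e & forall i' q : nat,
    fracpart R i <= fracpart R i' < fracpart R i + e -> (q < L)%N ->
    beatty R (i' + q) - beatty R i' = beatty R (i + q) - beatty R i.
Proof.
elim: L => [|L [e e0 He]]; first by exists 1.
pose y := fracpart R (i + L).
have y1 := fracpart_itv R (i + L); rewrite -/y in y1.
exists (Num.min e (1 - y)); first by rewrite lt_min e0; lra.
move=> i' q; set m := Num.min _ _ => fi; rewrite ltnS leq_eqVlt.
have me : m <= e by rewrite ge_min lexx.
have my : m <= 1 - y by rewrite ge_min lexx orbT.
case/orP => [/eqP ->|]; last by apply: He; lra.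
suff -> : beatty R (i' + L) = beatty R i' + (beatty R (i + L) - beatty R i) by ring.
apply: (@beatty_eq R _ _ (y + (fracpart R i' - fracpart R i))); last lra.
rewrite /y /fracpart !natrD !intrD !intrN; ring.
Qed.

Lemma fibword_recurrent (R : realType) (N i L : nat) (p : bool) :
  exists i' : nat, [/\ (N < i')%N, odd (zcount R 1 i'.-1) = p
    & forall q, (q < L)%N -> fibword R (i' + q) = fibword R (i + q)].
Proof.
(* [L] letters are differences of [L.+1] floors. *)
have [e e0 He] := beatty_right_stable R i L.+1.
have fi := fracpart_itv R i.
have [||| i' [i0 fi' podd]] := fracpart_dense_parity R N (fracpart R i)
  (Num.min (fracpart R i + e) 1) p.
- lra.
- by rewrite lt_min; lra.
- by rewrite ge_min lexx orbT.
exists i'; split => // q ltqL.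
have H : fracpart R i <= fracpart R i' < fracpart R i + e.
  by case/andP: fi' => h1; rewrite lt_min => /andP[h2 _]; lra.
have := He i' q H (ltnW _); have := He i' q.+1 H; rewrite !addnS.
rewrite !fibwordE => /(_ ltqL) h1 /(_ ltqL) h2; lia.
Qed.

(** * Values of [S] on the factors of T(f) *)

Lemma wfactor_iota {T : Type} (w : nat -> T) (i n : nat) :
  wfactor w i (i + n) = [seq w q | q <- iota i n.+1].
Proof. by rewrite /wfactor /index_iota -addnS addKn. Qed.

Lemma zeros_wfactor (R : realType) (i n : nat) :
  zeros (wfactor (fibword R) i (i + n)) = zcount R i n.+1.
Proof. by rewrite wfactor_iota. Qed.

Lemma sum_Fword (R : realType) (S0 S1 S2 i n : nat) :
  \sum_(i <= q < i + n) Fword R S0 S1 S2 q =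
    n%:R * S1%:R + (zcount R i n)%:R * kc R S0 S1 S2 1.
Proof.
elim: n => [|n IHn]; first by rewrite addn0 big_geq // !mul0r addr0.
rewrite addnS big_nat_recr ?leq_addr //= IHn zcountS natrD -natr1 /Fword.
by case: eqP => _ /=; ring.
Qed.

(* The zeros of f alternate between S0 and S2 in T(f), with mean [kc 1 + S1]; the
   parity [p] of the number of earlier zeros tells which one comes first. *)
Lemma S_factor (R : realType) {S0 S1 S2 : nat} {S : seq 'I_3 -> nat}
    (hS : forall u v : seq 'I_3, S (u ++ v) = (S u + S v)%N)
    (hSl0 : S [:: 0] = S0) (hSl1 : S [:: 1] = S1) (hSl2 : S [:: 2] = S2)
    (i n : nat) : (0 < i)%N ->
  (S [seq Tword (fibword R) q | q <- iota i n])%:R =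
    n%:R * S1%:R + (zcount R i n)%:R * kc R S0 S1 S2 1
    + (odd (zcount R i n))%:R * (-1) ^+ odd (zcount R 1 i.-1)
      * kc R S0 S1 S2 2.
Proof.
move=> i0; elim: n => [|n IHn].
  have -> : S [seq Tword (fibword R) q | q <- iota i 0] = 0%N.
    by have := hS [::] [::]; rewrite /=; lia.
  by rewrite /zcount /=; ring.
have -> : iota i n.+1 = iota i n ++ [:: (i + n)%N] by rewrite -addn1 iotaD.
rewrite map_cat hS natrD IHn zcountS oddD /=.
rewrite /Tword.
have -> : zeros (wfactor (fibword R) 1 (i + n)) = zcount R 1 (i + n).
  by rewrite -{1}(prednK i0) addSn -add1n zeros_wfactor -addSn prednK.
have -> : zcount R 1 (i + n) = (zcount R 1 i.-1 + zcount R i n.+1)%N.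
  by rewrite -{1}(prednK i0) addSn -addnS zcount_cat add1n prednK.
rewrite zcountS !oddD.
case: eqP => _; last by rewrite hSl1 addn0 addbF -[n.+1%:R]natr1; ring.
rewrite natrD -[n.+1%:R]natr1 /kc.
by case: (odd (zcount R i n)); case: (odd (zcount R 1 i.-1)) => /=;
  rewrite ?hSl0 ?hSl2 ?expr0 ?expr1; field.
Qed.

Definition shift (R : realType) (S0 S1 S2 r : nat) (b : bool) : R :=
  ec R S0 S1 S2 r + (oc R S0 S1 S2 r - ec R S0 S1 S2 r) * b%:R.

(** The left side is the deviation of [S] from [base n] on a factor of length n: [c] is the parity
    of the zeros of f[1, n-1], [b] the extra zero, [p] the parity of the zeros before the factor. *)
Lemma shift_of_parity (R : realType) (S0 S1 S2 : nat) (b c p : bool) :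
  exists r, (1 <= r <= 3)%N /\
    b%:R * kc R S0 S1 S2 1 + (c (+) b)%:R * (-1) ^+ p * kc R S0 S1 S2 2 =
    shift R S0 S1 S2 r c.
Proof.
exists (if b then if c || ~~ p then 1 else 2 else if c && ~~ p then 2 else 3)%N.
by case: b c p => [] [] [] /=; split=> //;
  rewrite /shift /ec /oc /kc /= ?expr0 ?expr1; field.
Qed.

Lemma parity_of_shift (R : realType) (S0 S1 S2 r : nat) (c : bool) :
  (1 <= r <= 3)%N -> exists b p : bool,
    b%:R * kc R S0 S1 S2 1 + (c (+) b)%:R * (-1) ^+ p * kc R S0 S1 S2 2 =
    shift R S0 S1 S2 r c.
Proof.
case: r => [|[|[|[|r]]]] // _;
  [exists true, false | exists (~~ c), (~~ c) | exists false, true].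
all: by case: c; rewrite /shift /ec /oc /kc /= ?expr0 ?expr1; field.
Qed.

Lemma shift_le_kmax (R : realType) (S0 S1 S2 r : nat) (b : bool) :
  (1 <= r <= 3)%N -> `|shift R S0 S1 S2 r b| <= kmax R S0 S1 S2.
Proof.
move=> r13.
have -> : shift R S0 S1 S2 r b = kc R S0 S1 S2 (if b then r else (r + 3)%N).
  by rewrite /shift /oc /ec; case: b => /=; ring.
apply: (le_bigmax_seq 0 _ xpredT (fun i => `|kc R S0 S1 S2 i|)) => //.
by rewrite mem_index_iota; case: b; lia.
Qed.

Lemma kmax_ge0 (R : realType) (S0 S1 S2 : nat) : 0 <= kmax R S0 S1 S2.
Proof. exact: le_trans (normr_ge0 _) (@shift_le_kmax R S0 S1 S2 1 true _). Qed.

(* Weight of the word 1f[1, n-1] of length n. *)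
Definition base (R : realType) (S0 S1 S2 n : nat) : R :=
  S1%:R + \sum_(1 <= q < n) Fword R S0 S1 S2 q.

Lemma baseE (R : realType) (S0 S1 S2 n : nat) : (0 < n)%N ->
  base R S0 S1 S2 n = n%:R * S1%:R + (zcount R 1 n.-1)%:R * kc R S0 S1 S2 1.
Proof.
case: n => // n _; rewrite /base -[n.+1]add1n sum_Fword natrD /=; ring.
Qed.

Lemma baseD (R : realType) (S0 S1 S2 i n : nat) : (0 < i)%N ->
  base R S0 S1 S2 (i + n) =
    base R S0 S1 S2 i + \sum_(i <= q < i + n) Fword R S0 S1 S2 q.
Proof.
by move=> i0; rewrite /base (big_cat_nat i0) ?leq_addr //= addrA.
Qed.

Definition attained (R : realType) (S0 S1 S2 : nat) (x : R) : Prop :=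
  exists r n : nat, [/\ (1 <= r <= 3)%N, (0 < n)%N &
    x = base R S0 S1 S2 n + shift R S0 S1 S2 r (odd (zcount R 1 n.-1))].

(* Both zero counts allowed for factors of a given length occur after an even
   and after an odd number of zeros. *)
Lemma language_attained (R : realType) {S0 S1 S2 : nat} {S : seq 'I_3 -> nat}
    (hS : forall u v : seq 'I_3, S (u ++ v) = (S u + S v)%N)
    (hSl0 : S [:: 0] = S0) (hSl1 : S [:: 1] = S1) (hSl2 : S [:: 2] = S2)
    (u : nat) : (0 < u)%N ->
  (S @` language (Tword (fibword R))) u <-> attained R S0 S1 S2 u%:R.
Proof.
move=> u0; split.
  move=> [w [i [s [i0 ->]]] Su].
  have [n n0 wE] : exists2 n, (0 < n)%N & wfactor (Tword (fibword R)) i s =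
      [seq Tword (fibword R) q | q <- iota i n].
    have [lesi|] := leqP s.+1 i.
      (* The empty factor has value 0, excluded by [u0]. *)
      move: Su u0; rewrite /wfactor /index_iota (eqP lesi) /=.
      by have := hS [::] [::]; rewrite /=; lia.
    by rewrite ltnS => leis; exists (s - i).+1; rewrite // -wfactor_iota subnKC.
  have [b zE] := zcount_range R i n n0.
  have [r [r13 rE]] := shift_of_parity R S0 S1 S2 b (odd (zcount R 1 n.-1))
    (odd (zcount R 1 i.-1)).
  exists r, n; split => //; rewrite -Su wE (S_factor R hS hSl0 hSl1 hSl2 i n i0).
  by rewrite -rE baseE // zE oddD oddb natrD; ring.
move=> [r [n [r13 n0 uE]]].
have [b [p rE]] := parity_of_shift R S0 S1 S2 r (odd (zcount R 1 n.-1)) r13.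
have [i [i0 zE pE]] := zcount_realize R n b p n0.
exists (wfactor (Tword (fibword R)) i (i + n.-1)); first by exists i, (i + n.-1)%N.
apply/eqP; rewrite -(eqr_nat R); apply/eqP; rewrite wfactor_iota prednK //.
rewrite (S_factor R hS hSl0 hSl1 hSl2 i n i0) uE -rE baseE // zE pE.
by rewrite oddD oddb natrD; ring.
Qed.

(** * Growth and integrality of the weights *)

Lemma Fword_ge (R : realType) (S0 S1 S2 q : nat) :
  Num.min S1%:R (kc R S0 S1 S2 1 + S1%:R) <= Fword R S0 S1 S2 q.
Proof. by rewrite /Fword; case: ifP => _; rewrite ge_min lexx ?orbT. Qed.

Lemma meanE (R : realType) (S0 S1 S2 : nat) :
  kc R S0 S1 S2 1 + S1%:R = (S0 + S2)%:R / 2.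
Proof. by rewrite /kc natrD; field. Qed.

Lemma sum_Fword_ge (R : realType) (S0 S1 S2 i n : nat) :
  n%:R * Num.min S1%:R (kc R S0 S1 S2 1 + S1%:R) <=
  \sum_(i <= q < i + n) Fword R S0 S1 S2 q.
Proof.
elim: n => [|n IHn]; first by rewrite addn0 big_geq ?mul0r.
rewrite addnS big_nat_recr ?leq_addr //= -natr1 mulrDl mul1r lerD //.
exact: Fword_ge.
Qed.

Lemma min_weight_gt0 (R : realType) (S0 S1 S2 : nat) : (0 < S0)%N -> (0 < S1)%N ->
  0 < Num.min S1%:R (kc R S0 S1 S2 1 + S1%:R).
Proof.
by move=> s0 s1; rewrite meanE lt_min ltr0n s1 divr_gt0 // ltr0n addn_gt0 s0.
Qed.

Lemma base_le (R : realType) (S0 S1 S2 i j : nat) : (0 < S0)%N -> (0 < S1)%N ->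
  (0 < i <= j)%N -> base R S0 S1 S2 i <= base R S0 S1 S2 j.
Proof.
move=> s0 s1 /andP[i0 leij]; rewrite -(subnKC leij) baseD // lerDl.
apply: le_trans (sum_Fword_ge R S0 S1 S2 i (j - i)).
by rewrite mulr_ge0 // ltW // min_weight_gt0.
Qed.

(** Two zeros together weigh the integer S0 + S2, so only an unpaired zero leaves a mean weight
    over. The bound makes [B] grow with [i]. *)
Lemma base_nat (R : realType) (S0 S1 S2 i : nat) :
  (0 < S0)%N -> (0 < S1)%N -> (0 < S2)%N -> (0 < i)%N ->
  exists2 B : nat, (i <= B.+1)%N &
  base R S0 S1 S2 i =
    B%:R + (odd (zcount R 1 i.-1))%:R * (kc R S0 S1 S2 1 + S1%:R).
Proof.
move=> s0 s1 s2 i0; rewrite baseE //; set z := zcount R 1 i.-1.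
have lezi : (z <= i.-1)%N := zcount_le R 1 i.-1.
exists ((i - z) * S1 + z./2 * (S0 + S2))%N.
  have h1 : (i - z <= (i - z) * S1)%N by rewrite leq_pmulr.
  have h2 : (z./2 * 2 <= z./2 * (S0 + S2))%N by rewrite leq_mul //; lia.
  clearbody z; have := odd_double_half z; lia.
have zE : (z%:R : R) = (odd z)%:R + 2 * (z./2)%:R.
  by rewrite -{1}(odd_double_half z) natrD -muln2 natrM mulrC.
rewrite natrD !natrM natrB; last lia.
by rewrite meanE {1 2}zE /kc natrD; field.
Qed.

Lemma lwin_ge (R : realType) (S0 S1 S2 : nat) : (0 < S0)%N -> (0 < S1)%N ->
  2 * (kmax R S0 S1 S2 + 1) <=
    (lwin R S0 S1 S2)%:R * Num.min S1%:R (kc R S0 S1 S2 1 + S1%:R).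
Proof.
move=> s0 s1; have m0 := min_weight_gt0 R S0 S1 S2 s0 s1.
rewrite -ler_pdivrMr // /lwin natr_absz ger0_norm ?ceil_ge //.
rewrite ceil_ge0 (lt_le_trans (ltrN10 R)) // divr_ge0 ?ltW //.
have := kmax_ge0 R S0 S1 S2; lra.
Qed.

Lemma lwin_gt0 (R : realType) (S0 S1 S2 : nat) : (0 < S0)%N -> (0 < S1)%N ->
  (0 < lwin R S0 S1 S2)%N.
Proof.
move=> s0 s1; have := lwin_ge R S0 S1 S2 s0 s1; case: lwin => // h.
have := kmax_ge0 R S0 S1 S2; lra.
Qed.

(* [p] is the parity of the number of zeros before position [i]; then
   [base i] is an integer plus [p * (kc 1 + S1)], which is why the integer
   points to be covered are those of [p * (kc 1 + S1) + I(F[i,j])]. *)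
Definition window_covered (R : realType) (S0 S1 S2 : nat) (p : bool) (i : nat) :
    Prop :=
  forall y : R,
    Iset R S0 S1 S2 i (i + lwin R S0 S1 S2 - 1) y ->
    naturals R (p%:R * (kc R S0 S1 S2 1 + S1%:R) + y) ->
    exists r t : nat, [/\ (1 <= r <= 3)%N, (t < lwin R S0 S1 S2)%N &
      y = \sum_(i <= q < i + t.+1) Fword R S0 S1 S2 q
          + shift R S0 S1 S2 r (odd (zcount R i t.+1) (+) p)].

(** * Empty sets K as covered windows *)

Lemma Kset0_eq0 (R : realType) (S0 S1 S2 i : nat) : (0 < S0)%N -> (0 < S1)%N ->
  Kset0 R S0 S1 S2 i (i + lwin R S0 S1 S2 - 1) = set0 <->
  window_covered R S0 S1 S2 false i.
Proof.
move=> s0 s1; have l0 := lwin_gt0 R S0 S1 S2 s0 s1; split => [K0 y Iy Ny|cov].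
  apply: contrapT => nex; have : Kset0 R S0 S1 S2 i (i + lwin R S0 S1 S2 - 1) y.
    split; last by rewrite mul0r add0r in Ny.
    split => // -[r [s [r13 ijs yE]]]; apply: nex; exists r, (s - i)%N.
    have isE : (i + (s - i) = s)%N by lia.
    split => //; first lia.
    by rewrite yE -{2}isE zeros_wfactor modn2 addbF addnS isE /shift addrA.
  by rewrite K0.
apply/seteqP; split => // y [[Iy Sy] Ny]; apply: Sy.
have [|r [t [r13 tl yE]]] := cov y Iy; first by rewrite mul0r add0r.
exists r, (i + t)%N; split => //; first lia.
by rewrite yE -addnS zeros_wfactor modn2 addbF /shift addrA.
Qed.

Lemma Kset1_eq0 (R : realType) (S0 S1 S2 i : nat) : (0 < S0)%N -> (0 < S1)%N ->
  Kset1 R S0 S1 S2 i (i + lwin R S0 S1 S2 - 1) = set0 <->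
  window_covered R S0 S1 S2 true i.
Proof.
move=> s0 s1; have l0 := lwin_gt0 R S0 S1 S2 s0 s1.
(* Turns the complemented parity in [Sset1] into a parity flipped by p = true. *)
have natrC (b : bool) : 1 - (b%:R : R) = (b (+) true)%:R by case: b => /=; ring.
split => [K0 y Iy Ny|cov].
  apply: contrapT => nex.
  have : Kset1 R S0 S1 S2 i (i + lwin R S0 S1 S2 - 1) (kc R S0 S1 S2 1 + S1%:R + y).
    split; last by rewrite mul1r in Ny.
    split; first by exists y.
    move=> [y' [r [s [r13 ijs yE]]] /addrI y'y]; apply: nex; exists r, (s - i)%N.
    have isE : (i + (s - i) = s)%N by lia.
    split => //; first lia.
    by rewrite -y'y yE -{2}isE zeros_wfactor modn2 natrC addnS isE /shift addrA.
  by rewrite K0.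
apply/seteqP; split => // _ [[[y Iy <-] Sy] Ny]; apply: Sy; exists y => //.
have [|r [t [r13 tl yE]]] := cov y Iy; first by rewrite mul1r.
exists r, (i + t)%N; split => //; first lia.
by rewrite yE -addnS zeros_wfactor modn2 natrC /shift addrA.
Qed.

Lemma odd_zcount_split (R : realType) (i t : nat) : (0 < i)%N ->
  odd (zcount R 1 (i + t).-1) = odd (zcount R i t) (+) odd (zcount R 1 i.-1).
Proof.
by case: i => // i _; rewrite addSn /= zcount_cat oddD addbC add1n.
Qed.

(** For j = i + l - 1 the sum in I ends at j + 1, hence has l + 1 terms. *)
Lemma Iset_window (R : realType) (S0 S1 S2 i : nat) (y : R) :
  (0 < lwin R S0 S1 S2)%N ->
  Iset R S0 S1 S2 i (i + lwin R S0 S1 S2 - 1) y <->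
  kmax R S0 S1 S2 + 1 <= y <=
    \sum_(i <= q < i + (lwin R S0 S1 S2).+1) Fword R S0 S1 S2 q
    - (kmax R S0 S1 S2 + 1).
Proof.
move=> l0; rewrite /Iset /= in_itv /=.
by have -> : ((i + lwin R S0 S1 S2 - 1).+2 = i + (lwin R S0 S1 S2).+1)%N by lia.
Qed.

(* Every pattern of f recurs arbitrarily far with a prescribed parity of zeros
   before it, and near [base i'] only the lengths in the window contribute. *)
Lemma attained_window (R : realType) (S0 S1 S2 N : nat) (p : bool) (i : nat) :
  (0 < S0)%N -> (0 < S1)%N -> (0 < S2)%N -> (0 < i)%N ->
  (forall u : nat, (N <= u)%N -> attained R S0 S1 S2 u%:R) ->
  window_covered R S0 S1 S2 p i.
Proof.
move=> s0 s1 s2 i0 att y; have l0 := lwin_gt0 R S0 S1 S2 s0 s1.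
set l := lwin _ _ _ _ in l0 *.
move=> /(Iset_window _ _ _ _ _ _ l0) /andP[ylo yhi] [x _ xE].
(* All l + 1 letters are copied, since the upper end of I involves the last one; i' > N ensures B +
   x >= N below. *)
have [i' [ltNi' pE fE]] := fibword_recurrent R N i l.+1 p.
have i'0 : (0 < i')%N by lia.
have FE t : (t <= l.+1)%N -> \sum_(i' <= q < i' + t) Fword R S0 S1 S2 q =
    \sum_(i <= q < i + t) Fword R S0 S1 S2 q.
  move=> tl; rewrite -{1}[i']add0n -{1}[i]add0n !(addnC _ t) !big_addn !addnK.
  by apply: eq_big_nat => q ltqt; rewrite /Fword !(addnC q) fE //; lia.
have zE t : (t <= l.+1)%N -> zcount R i' t = zcount R i t.
  elim: t => // t IHt ltl; rewrite !zcountS IHt; last lia.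
  by rewrite fE.
have [B leB BE] := base_nat R S0 S1 S2 i' s0 s1 s2 i'0.
rewrite pE in BE.
have [|r [n [r13 n0 nE]]] := att (B + x)%N; first lia.
have {}nE : base R S0 S1 S2 i' + y =
    base R S0 S1 S2 n + shift R S0 S1 S2 r (odd (zcount R 1 n.-1)).
  by rewrite -nE natrD xE BE; ring.
have := shift_le_kmax R S0 S1 S2 r (odd (zcount R 1 n.-1)) r13.
rewrite ler_norml => /andP[slo shi].
(* Lengths up to i' give values at most base i' + k, which is too small. *)
have lti'n : (i' < n)%N.
  rewrite ltnNge; apply/negP => le_n.
  have := base_le R S0 S1 S2 n i' s0 s1; rewrite n0 le_n => /(_ isT); lra.
(* Lengths above i' + l give values at least base (i' + l + 1) - k, which is too large. *)
have ltnl : (n <= i' + l)%N.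
  rewrite leqNgt; apply/negP; rewrite -addnS => le_n.
  have := base_le R S0 S1 S2 (i' + l.+1) n s0 s1; rewrite le_n addn_gt0 i'0 => /(_ isT).
  by rewrite baseD // FE //; lra.
have nE' : (i' + (n - i').-1.+1 = n)%N by lia.
exists r, (n - i').-1; split => //; first lia.
have tl : ((n - i').-1.+1 <= l.+1)%N by lia.
rewrite -FE // -zE // -pE -odd_zcount_split // nE'.
have bE := baseD R S0 S1 S2 i' (n - i').-1.+1 i'0.
by move: nE; rewrite nE' in bE; rewrite bE -[RHS]addrA => /addrI.
Qed.

(* Consecutive windows overlap, since [l] letters weigh at least [2 * (k + 1)]. *)
Lemma window_attained (R : realType) (S0 S1 S2 : nat) :
  (0 < S0)%N -> (0 < S1)%N -> (0 < S2)%N ->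
  (forall p i, (0 < i)%N -> window_covered R S0 S1 S2 p i) ->
  forall u : nat, base R S0 S1 S2 1 + kmax R S0 S1 S2 + 1 <= u%:R ->
  attained R S0 S1 S2 u%:R.
Proof.
move=> s0 s1 s2 cov u ulo; have l0 := lwin_gt0 R S0 S1 S2 s0 s1.
(* The window starts at the largest [i] satisfying [P]; [base_nat] bounds such [i] by [u]. *)
pose P i := (0 < i)%N && (base R S0 S1 S2 i + kmax R S0 S1 S2 + 1 <= u%:R).
have k0 := kmax_ge0 R S0 S1 S2.
have Pub i : P i -> (i <= u)%N.
  move=> /andP[i0 iu]; have [B leB BE] := base_nat R S0 S1 S2 i s0 s1 s2 i0.
  have c0 : 0 <= (odd (zcount R 1 i.-1))%:R * (kc R S0 S1 S2 1 + S1%:R).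
    by rewrite meanE mulr_ge0 // divr_ge0.
  have : (B.+1%:R : R) <= u%:R by rewrite -natr1; lra.
  rewrite ler_nat; lia.
have exP : exists i, P i by exists 1%N; rewrite /P ulo.
have [i /andP[i0 iu] imax] := ex_maxnP exP Pub.
have ltu : u%:R < base R S0 S1 S2 i.+1 + kmax R S0 S1 S2 + 1.
  rewrite ltNge; apply/negP => le_u; have := imax i.+1.
  by rewrite /P le_u => /(_ isT); rewrite ltnn.
have [B leB BE] := base_nat R S0 S1 S2 i s0 s1 s2 i0.
have c0 : 0 <= (odd (zcount R 1 i.-1))%:R * (kc R S0 S1 S2 1 + S1%:R).
  by rewrite meanE mulr_ge0 // divr_ge0.
have [|| r [t [r13 tl yE]]] :=
  cov (odd (zcount R 1 i.-1)) i i0 (u%:R - base R S0 S1 S2 i).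
(* By maximality u < base (i + 1) + k + 1, and the l letters from i + 1 on weigh at least 2(k +
   1). *)
- apply/Iset_window => //.
  have := baseD R S0 S1 S2 i (lwin R S0 S1 S2).+1 i0.
  have := baseD R S0 S1 S2 i.+1 (lwin R S0 S1 S2) isT; rewrite addSnnS => -> h.
  have := sum_Fword_ge R S0 S1 S2 i.+1 (lwin R S0 S1 S2).
  have := lwin_ge R S0 S1 S2 s0 s1; rewrite addSnnS; lra.
- exists (u - B)%N => //; rewrite natrB; first by rewrite BE; ring.
  by rewrite -(ler_nat R); lra.
exists r, (i + t.+1)%N; split => //; first by rewrite addn_gt0 i0.
by rewrite baseD // odd_zcount_split // -addrA -yE addrCA subrr addr0.
Qed.

Lemma finite_complement_natP (A : set nat) :
  finite_set ([set: nat] `\` A) <-> exists N, forall u, (N <= u)%N -> A u.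
Proof.
split => [/finite_seqP[s sE]|[N hN]].
  exists (\max_(v <- s) v).+1 => u ltu; apply: contrapT => nAu.
  have : ([set: nat] `\` A) u by [].
  rewrite sE /= => us; have := @leq_bigmax_seq _ s xpredT id u us isT.
  by rewrite leqNgt ltu.
apply: (@sub_finite_set _ _ `I_N); last exact: finite_II.
by move=> u [_ nAu]; rewrite /= ltnNge; apply/negP => /hN.
Qed.

Theorem theorem22 (R : realType) (S0 S1 S2 : nat)
    (hS0 : (0 < S0)%N) (hS1 : (0 < S1)%N) (hS2 : (0 < S2)%N)
    (hgcd : gcdn (gcdn S0 S1) S2 = 1%N)
    (S : seq 'I_3 -> nat)
    (hS : forall u v : seq 'I_3, S (u ++ v) = (S u + S v)%N)
    (hSl0 : S [:: 0] = S0) (hSl1 : S [:: 1] = S1) (hSl2 : S [:: 2] = S2) :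
  finite_set ([set: nat] `\` S @` language (Tword (fibword R))) <->
  (forall i : nat, (1 <= i)%N ->
     Kset0 R S0 S1 S2 i (i + lwin R S0 S1 S2 - 1) = set0 /\
     Kset1 R S0 S1 S2 i (i + lwin R S0 S1 S2 - 1) = set0).
Proof.
have langP := language_attained R hS hSl0 hSl1 hSl2.
rewrite finite_complement_natP; split => [[N hN] i i0|K0].
  (* Starting at [N.+1] keeps [u] positive, as [langP] requires. *)
  have att u : (N.+1 <= u)%N -> attained R S0 S1 S2 u%:R.
    by move=> ltNu; apply/langP; [lia|apply: hN; lia].
  split; [apply/Kset0_eq0|apply/Kset1_eq0] => //.
    exact: attained_window att.
  exact: attained_window att.
have cov p i : (0 < i)%N -> window_covered R S0 S1 S2 p i.
  by move=> i0; have [/Kset0_eq0 c0 /Kset1_eq0 c1] := K0 i i0; case: p; auto.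
exists (Num.bound `|base R S0 S1 S2 1 + kmax R S0 S1 S2 + 1|).+1 => u ltu.
apply/langP; first lia.
apply: window_attained => //; apply: (le_trans (ler_norm _)); apply: ltW.
apply: lt_le_trans (archi_boundP (normr_ge0 _)) _.
by rewrite ler_nat ltnW.
Qed.
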